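(* Let $\mathcal{B}$ be a greedy basis of a quasi-Banach space $\mathbb{X}$. There is a renorming of $\mathbb{X}$ with respect to which $C_g=K_u=1$.
   Context: The scalar field $\mathbb{F}$ is $\mathbb{R}$ or $\mathbb{C}$. A quasi-norm satisfies the axioms of a norm except that the triangle inequality is replaced by $\Vert f+g\Vert\le\kappa(\Vert f\Vert+\Vert g\Vert)$ for some $\kappa\ge1$ (it need not be a continuous function); a quasi-Banach space is a vector space complete for the topology of a quasi-norm. A renorming of $(\mathbb{X},\Vert\cdot\Vert)$ is another quasi-norm on $\mathbb{X}$ inducing the same topology, i.e., equivalent to $\Vert\cdot\Vert$. A basis of $\mathbb{X}$ is a sequence $\mathcal{B}=(\mathbf{x}_n)_{n=1}^\infty$ whose closed linear span is $\mathbb{X}$ and for which there is a (unique) sequence $(\mathbf{x}_n^* )_{n=1}^\infty$ in $\mathbb{X}^*$ with $\mathbf{x}_n^*(\mathbf{x}_k)=\delta_{k,n}$. It is $M$-bounded if $\sup_n\Vert\mathbf{x}_n\Vert\,\Vert\mathbf{x}_n^*\Vert<\infty$ and semi-normalized if $0<\inf_n\Vert\mathbf{x}_n\Vert\le\sup_n\Vert\mathbf{x}_n\Vert<\infty$. Put $\mathrm{supp}(f)=\{n:\mathbf{x}_n^*(f)\ne0\}$; for finite $A\subseteq\mathbb{N}$, $S_A(f)=\sum_{n\in A}\mathbf{x}_n^*(f)\mathbf{x}_n$. A set $A\subseteq\mathbb{N}$ is a greedy set of $f$ if $|\mathbf{x}_k^*(f)|\le|\mathbf{x}_n^*(f)|$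 for all $n\in A$, $k\in\mathbb{N}\setminus A$. A greedy basis is an $M$-bounded semi-normalized basis for which there is $C\ge1$ with $\Vert f-S_A(f)\Vert\le C\Vert f-z\Vert$ whenever $A$ is a finite greedy set of $f\in\mathbb{X}$ and $z\in\mathbb{X}$ satisfies $|\mathrm{supp}(z)|\le|A|$; the smallest such $C$ is $C_g$. For $\gamma=(c_n)\in\ell_\infty$, $M_\gamma$ is the linear map $\sum a_n\mathbf{x}_n\mapsto\sum c_na_n\mathbf{x}_n$ on the linear span of $\mathcal{B}$, extended to $\mathbb{X}$ by continuity when it is continuous, and $K_u=\sup_{\Vert\gamma\Vert_\infty\le1}\Vert M_\gamma\Vert$ is the lattice unconditional constant. All constants are computed with respect to the quasi-norm under consideration. *)

(* Defs.v *)
From HB Require Import structures.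
From mathcomp Require Import all_boot all_order all_algebra finmap.
From mathcomp Require Import complex.
From mathcomp Require Import all_classical all_reals.
From mathcomp Require Import ereal topology normedtype.

Set Implicit Arguments.
Unset Strict Implicit.
Unset Printing Implicit Defensive.
Import Order.TTheory GRing.Theory Num.Theory numFieldNormedType.Exports.
Local Open Scope classical_set_scope.
Local Open Scope ring_scope.

Variant scalar_kind := RealScalars | ComplexScalars.

Definition scalars (R : realType) (k : scalar_kind) : numFieldType :=
  match k with
  | RealScalars => R
  | ComplexScalars => R[i]
  end.

(* The norm `|a| of MathComp takes its values in the scalar field itself; the
   quasi-norms below are R-valued, so the modulus is needed as an element of R
   also for complex scalars. *)
Definition modulus (R : realType) (k : scalar_kind) : scalars R k -> R :=
  match k return scalars R k -> R with
  | RealScalars => fun a => `|a|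
  | ComplexScalars => fun a => Normc.normc a
  end.

Section QuasiNorm.
Variables (R : realType) (k : scalar_kind).
Local Notation K := (scalars R k).

Definition quasi_norm (V : lmodType K) (N : V -> R) : Prop :=
  [/\ forall f, 0 <= N f,
      forall f, N f = 0 -> f = 0,
      forall (a : K) f, N (a *: f) = modulus a * N f
    & exists2 kappa : R, 1 <= kappa &
        forall f g, N (f + g) <= kappa * (N f + N g)].

Definition qball (V : lmodType K) (N : V -> R) (f : V) (e : R) : set V :=
  [set g | N (f - g) < e].

Variable X : preTopologicalLmodType K.
Implicit Types (N : X -> R) (x : nat -> X) (xs : nat -> {scalar X}).

(* Balls of a quasi-norm need not be open, but they form a base of
   neighbourhoods. *)
Definition induces_topology N : Prop :=
  forall f : X, nbhs f = filter_from [set e : R | 0 < e] (qball N f).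

Definition quasi_norm_complete N : Prop :=
  forall F : set_system X, ProperFilter F ->
    (forall e : R, 0 < e -> exists f, F (qball N f e)) ->
    exists f : X, F --> f.

Definition quasi_Banach N : Prop :=
  [/\ quasi_norm N, induces_topology N & quasi_norm_complete N].

(* The topology of X is fixed by the quasi-norm of quasi_Banach, so a renorming
   is any quasi-norm that induces it. *)
Definition renorming N : Prop := quasi_norm N /\ induces_topology N.

(* M is the quasi-norm, or the modulus, on the codomain. *)
Definition op_norm N (V : Type) (M : V -> R) (T : X -> V) : \bar R :=
  ereal_sup [set (M (T f))%:E | f in [set f | N f <= 1]].

Definition lin_span x : set X :=
  [set f | exists m (a : nat -> K), f = \sum_(n < m) a n *: x n].

(* The coordinate functionals xs are determined by x, as lin_span x is dense. *)
Definition is_basis x xs : Prop :=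
  [/\ closure (lin_span x) = [set: X],
      forall n, continuous (xs n : X -> K)
    & forall n j, xs n (x j) = (j == n)%:R].

Definition M_bounded N x xs : Prop :=
  (ereal_sup (range (fun n =>
     (N (x n))%:E * op_norm N (@modulus R k) (xs n))) < +oo)%E.

Definition semi_normalized N x : Prop :=
  (0 < ereal_inf (range (fun n => (N (x n))%:E)) /\
   ereal_sup (range (fun n => (N (x n))%:E)) < +oo)%E.

Definition supp xs (f : X) : set nat := [set n | xs n f != 0].

Definition partial_sum x xs (A : {fset nat}) (f : X) : X :=
  \sum_(n <- A) xs n f *: x n.

Definition greedy_set xs (f : X) (A : set nat) : Prop :=
  forall n j, A n -> ~ A j -> modulus (xs j f) <= modulus (xs n f).

Definition greedy_bound N x xs (C : R) : Prop :=
  forall (f : X) (A : {fset nat}) (z : X),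
    greedy_set xs f [set` A] -> (supp xs z #<= [set` A])%card ->
    N (f - partial_sum x xs A f) <= C * N (f - z).

Definition greedy_basis N x xs : Prop :=
  [/\ is_basis x xs, M_bounded N x xs, semi_normalized N x
    & exists2 C : R, 1 <= C & greedy_bound N x xs C].

(* The infimum is attained whenever the set is non-empty. *)
Definition greedy_constant N x xs : \bar R :=
  ereal_inf [set C%:E | C in [set C : R | 1 <= C /\ greedy_bound N x xs C]].

(* The continuous extensions to X of the map sum a_n x_n |-> sum c_n a_n x_n on
   lin_span x: at most one operator, and none if that map is not continuous. *)
Definition multiplier x (c : nat -> K) : set {linear X -> X} :=
  [set T : {linear X -> X} | continuous (T : X -> X) /\
     forall m (a : nat -> K),
       T (\sum_(n < m) a n *: x n) = \sum_(n < m) (c n * a n) *: x n].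

(* As multiplier x c has at most one element, the infimum is the norm of that
   element, and +oo if the multiplier is not continuous. *)
Definition multiplier_norm N x (c : nat -> K) : \bar R :=
  ereal_inf [set op_norm N N T | T in multiplier x c].

Definition linfty_norm (c : nat -> K) : \bar R :=
  ereal_sup (range (fun n => (modulus (c n))%:E)).

Definition lattice_unconditional_constant N x : \bar R :=
  ereal_sup [set multiplier_norm N x c | c in [set c | linfty_norm c <= 1]%E].

End QuasiNorm.

(* Main.v *)
(** Write [|f|] for the sequence of moduli of the coefficients of [f].  Call [g]
    dominated by [h] if [|g| <= |h|] off a finite set [E], where [g] vanishes on
    a finite set [F] disjoint from [E] with [#E <= #F], and every coefficient of
    [h] on [F] is at least as large as every coefficient of [g]: the
    coefficients of [h] on [F] have been traded for smaller ones on [E].  This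
    relation is transitive, it contains [|g| <= |h|], and [f - S_A f] is
    dominated by [f - z] whenever [A] is a greedy set of [f] and
    [#supp z <= #A].  Hence [N' h = sup {N g : g dominated by h}] satisfies
    [C_g = K_u = 1], provided that it is equivalent to [N]; as [N'] need only be
    a quasi-norm, equivalence also gives its triangle inequality.

    For the equivalence, [N g <= kappa (N (g - S_E g) + N (S_E g))].  The first
    term is controlled by lattice unconditionality; the second by
    [C * N (S_F h)], from the greedy inequality for [S_E g + S_F h] with greedy
    set [F] and [z = S_E g]. *)
Require Import Defs.
From mathcomp Require Import all_boot all_order all_algebra finmap.
From HB Require Import structures.
From mathcomp Require Import complex.
From mathcomp Require Import all_classical all_reals.
From mathcomp Require Import ereal topology normedtype.
From mathcomp Require Import ring lra zify.

Set Implicit Arguments.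
Unset Strict Implicit.
Unset Printing Implicit Defensive.
Import Order.TTheory GRing.Theory Num.Theory numFieldNormedType.Exports.
Local Open Scope classical_set_scope.
Local Open Scope ring_scope.

(** * The modulus over both scalar fields *)

Section Modulus.
Variables (R : realType) (k : scalar_kind).
Local Notation K := (scalars R k).
Implicit Types a b : K.

Lemma modulus_ge0 a : 0 <= modulus a.
Proof.
case: k a => /= [a|[a b]]; first exact: normr_ge0.
exact: sqrtr_ge0.
Qed.

Lemma modulus0 : modulus (0 : K) = 0.
Proof. by case: k; [exact: normr0|exact: Normc.normc0]. Qed.

Lemma modulus_eq0 a : modulus a = 0 -> a = 0.
Proof. by case: k a; [exact: normr0_eq0|exact: Normc.eq0_normc]. Qed.

Lemma modulus1 : modulus (1 : K) = 1.
Proof. by case: k; [exact: normr1|exact: Normc.normc1]. Qed.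

Lemma modulusM a b : modulus (a * b) = modulus a * modulus b.
Proof. by case: k a b; [exact: normrM|exact: Normc.normcM]. Qed.

Lemma modulusD a b : modulus (a + b) <= modulus a + modulus b.
Proof. by case: k a b; [exact: ler_normD|exact: le_normcD]. Qed.

Lemma modulusN a : modulus (- a) = modulus a.
Proof. by case: k a; [exact: normrN|exact: normcN]. Qed.

Lemma modulusV a : modulus a^-1 = (modulus a)^-1.
Proof. by case: k a; [exact: normfV|exact: Normc.normcV]. Qed.

Lemma modulus_nat n : modulus (n%:R : K) = n%:R.
Proof.
case: k => /=; first exact: normr_nat.
by rewrite normcMn Normc.normc1.
Qed.

Lemma modulus_surj (r : R) : 0 <= r -> exists a : K, modulus a = r.
Proof.
case: k => /= r0; [exists r|exists (Complex r 0)]; first exact: ger0_norm.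
by rewrite /= expr0n addr0 sqrtr_sqr ger0_norm.
Qed.

End Modulus.

(** * Finite nets of scalars, absorption of a half, and cardinalities of finite sets *)

Lemma real_net (R : realType) (m : nat) :
  exists D : seq R, forall a, `|a| <= 1 -> 
    exists2 d, d \in D & `|a - d| <= m.+1%:R^-1.
Proof.
(* A grid of step [m.+1%:R^-1] from -1 to 1; [a] is rounded down to it. *)
exists [seq i%:R / m.+1%:R - 1 | i <- iota 0 (m.+1 * 2).+1] => a.
rewrite ler_norml => /andP[a0 a1].
have m0 : 0 < m.+1%:R :> R by rewrite ltr0n.
have y0 : 0 <= (a + 1) * m.+1%:R by rewrite mulr_ge0 ?(ltW m0)//; lra.
have /andP[tl tr] := truncn_itv y0.
exists ((Num.truncn ((a + 1) * m.+1%:R))%:R / m.+1%:R - 1).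
  apply/mapP; exists (Num.truncn ((a + 1) * m.+1%:R)) => //.
  rewrite mem_iota add0n /= ltnS -(@ler_nat R).
  apply: le_trans tl _; rewrite natrM mulrC ler_pM2l//; lra.
have -> : a - ((Num.truncn ((a + 1) * m.+1%:R))%:R / m.+1%:R - 1) =
  ((a + 1) * m.+1%:R - (Num.truncn ((a + 1) * m.+1%:R))%:R) / m.+1%:R.
  by field; rewrite gt_eqF// addr_gt0//.
rewrite normrM (ger0_norm (x := m.+1%:R^-1)) ?invr_ge0 ?ler0n//.
rewrite -[leRHS]mul1r ler_pM2r ?invr_gt0// ler_norml.
rewrite -(natr1 (Num.truncn _)) in tr.
by move: tl tr; set t := _%:R; set y := _ * _ => tl tr; apply/andP; split; lra.
Qed.

Lemma modulus_net (R : realType) (k : scalar_kind) (m : nat) :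
  exists D : seq (scalars R k), forall a, modulus a <= 1 ->
    exists2 d, d \in D & modulus (a - d) <= m.+1%:R^-1.
Proof.
case: k => /=; first exact: real_net.
(* Half the mesh, as the errors of the real and the imaginary part add up. *)
have [D netD] := real_net R (m.+1 * 2).-1.
exists [seq Complex u v | u <- D, v <- D] => -[a b] ab.
have normcE (u v : R) : Normc.normc (Complex u v) = Num.sqrt (u ^+ 2 + v ^+ 2).
  by [].
have [u uD au] : exists2 d, d \in D & `|a - d| <= (m.+1 * 2).-1.+1%:R^-1.
  apply: netD; apply: le_trans ab.
  by rewrite normcE -sqrtr_sqr ler_wsqrtr// lerDl sqr_ge0.
have [v vD bv] : exists2 d, d \in D & `|b - d| <= (m.+1 * 2).-1.+1%:R^-1.
  apply: netD; apply: le_trans ab.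
  by rewrite normcE -sqrtr_sqr ler_wsqrtr// lerDr sqr_ge0.
exists (Complex u v); first exact: allpairs_f.
rewrite [X in Normc.normc X](_ : _ = Complex (a - u) (b - v))// normcE.
have -> : m.+1%:R^-1 = (m.+1 * 2).-1.+1%:R^-1 + (m.+1 * 2).-1.+1%:R^-1 :> R.
  by rewrite prednK ?muln_gt0// natrM; field; rewrite addrC natr1 pnatr_eq0.
apply: le_trans (lerD au bv).
rewrite -[leRHS]ger0_norm ?addr_ge0// -sqrtr_sqr ler_wsqrtr//.
rewrite -[in leLHS]real_normK ?num_real// -[(b - v) ^+ 2]real_normK ?num_real//.
by rewrite sqrrD -addrA lerD2l lerDr mulrn_wge0// mulr_ge0.
Qed.

(** The hypothesis gives [sup S <= Q + sup S / 2], and the half can be absorbed because [sup S] is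
    finite. *)
Lemma halving_bound (R : realType) (S : set R) (Q : R) : has_ubound S ->
  (forall a, S a -> exists2 b, S b & a <= Q + b / 2) ->
  forall a, S a -> a <= 2 * Q.
Proof.
move=> bS hS a Sa; have := ub_le_sup bS Sa.
suff : sup S <= Q + sup S / 2 by lra.
apply: ge_sup; first by exists a.
move=> b /hS[c Sc /le_trans]; apply; rewrite lerD2l.
by rewrite ler_pM2r// ub_le_sup.
Qed.

Lemma card_fset_le (T : choiceType) (A B : {fset T}) :
  ([set` A] #<= [set` B])%card = (#|` A| <= #|` B|)%N.
Proof.
have cardI (D : {fset T}) : ([set` D] #= `I_#|` D|)%card.
  exact/card_eq_fsetP.
by rewrite (card_le_eql (cardI A)) (card_le_eqr (cardI B)) card_le_II.
Qed.

(** * Elementary properties of quasi-norms *)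

Section QuasiNorm.
Variables (R : realType) (k : scalar_kind) (V : lmodType (scalars R k)).
Variable N : V -> R.
Hypothesis qN : quasi_norm N.

Lemma qnorm_ge0 f : 0 <= N f. Proof. by case: qN. Qed.

Lemma qnorm_eq0 f : N f = 0 -> f = 0. Proof. by case: qN => _ + _ _; apply. Qed.

Lemma qnormZ a f : N (a *: f) = modulus a * N f. Proof. by case: qN. Qed.

Lemma qnorm0 : N 0 = 0.
Proof. by rewrite -(scale0r 0) qnormZ modulus0 mul0r. Qed.

Lemma qnormN f : N (- f) = N f.
Proof. by rewrite -scaleN1r qnormZ modulusN modulus1 mul1r. Qed.

Lemma qnormD_kappa : exists2 kappa : R, 1 <= kappa &
  forall f g, N (f + g) <= kappa * (N f + N g).
Proof. by case: qN. Qed.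

(** Each summand costs a factor [kappa], so [M] depends on the list [s], but not on the vectors
    [u]. *)
Lemma qnorm_sum (I : eqType) (s : seq I) :
  exists2 M : R, 0 <= M & forall (u : I -> V) b, 0 <= b ->
    (forall i, i \in s -> N (u i) <= b) -> N (\sum_(i <- s) u i) <= M * b.
Proof.
have [kappa k1 NK] := qnormD_kappa.
elim: s => [|i s [M M0 IH]].
  by exists 0 => // u b b0 _; rewrite big_nil qnorm0 mul0r.
exists (kappa * (1 + M)); first by rewrite mulr_ge0 ?addr_ge0//; lra.
move=> u b b0 ub; rewrite big_cons; apply: le_trans (NK _ _) _.
rewrite -mulrA ler_pM2l; last by lra.
rewrite mulrDl mul1r lerD ?ub ?mem_head// IH// => j js.
by rewrite ub// in_cons js orbT.
Qed.

End QuasiNorm.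

(** * Coefficients of finite expansions *)

Section Coordinates.
Variables (R : realType) (k : scalar_kind).
Variable X : preTopologicalLmodType (scalars R k).
Local Notation K := (scalars R k).
Variables (x : nat -> X) (xs : nat -> {scalar X}).
Hypothesis xs_x : forall n j, xs n (x j) = (j == n)%:R.

Lemma coef_sum (I : seq nat) (a : nat -> K) j : uniq I ->
  xs j (\sum_(n <- I) a n *: x n) = if j \in I then a j else 0.
Proof.
move=> uI; rewrite linear_sum /=.
under eq_bigr do rewrite linearZ /= xs_x.
have [jI|jI] := ifPn.
  rewrite (bigD1_seq j)//= eqxx mulr1 big1 ?addr0// => i /negPf ->.
  by rewrite mulr0.
rewrite big_seq big1// => i iI; case: eqP => [ij|_]; last by rewrite mulr0.
by rewrite -ij iI in jI.
Qed.

Lemma coef_sum_ord m (a : nat -> K) j :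
  xs j (\sum_(n < m) a n *: x n) = if (j < m)%N then a j else 0.
Proof.
rewrite -(big_mkord xpredT (fun n => a n *: x n)) coef_sum ?iota_uniq//.
by rewrite mem_index_iota.
Qed.

Lemma coef_partial_sum A f j :
  xs j (partial_sum x xs A f) = if j \in A then xs j f else 0.
Proof. by rewrite /partial_sum coef_sum ?fset_uniq. Qed.

Lemma partial_sumB A f g :
  partial_sum x xs A (f - g) = partial_sum x xs A f - partial_sum x xs A g.
Proof.
rewrite /partial_sum -sumrB; apply: eq_bigr => n _.
by rewrite linearB scalerBl.
Qed.

(** Grouping the indices by the value of [d] leaves a number of projections bounded by the size of
    [D], whatever the size of [A]. *)
Lemma partial_sum_level (d : nat -> K) (D : seq K) (A : {fset nat}) f :
  (forall n, d n \in D) ->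
  \sum_(n <- A) (d n * xs n f) *: x n =
  \sum_(a <- undup D) a *: partial_sum x xs [fset n in A | d n == a]%fset f.
Proof.
move=> dD.
transitivity
    (\sum_(a <- undup D) \sum_(n <- A | d n == a) (d n * xs n f) *: x n).
  rewrite (exchange_big_dep xpredT)//=; apply: eq_bigr => n _.
  rewrite -big_filter (_ : [seq _ <- _ | _] = [:: d n]) ?big_seq1//.
  rewrite (eq_filter (a2 := pred1 (d n))) => [|a]; last exact: eq_sym.
  by rewrite filter_pred1_uniq ?undup_uniq ?mem_undup.
apply: eq_bigr => a _; rewrite scaler_sumr big_fset /=.
by apply: eq_bigr => n /eqP ->; rewrite scalerA.
Qed.

End Coordinates.

Lemma sum_segment (V : nmodType) m (F : nat -> V) :
  \sum_(n <- [fset n in iota 0 m]%fset) F n = \sum_(n < m) F n.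
Proof.
rewrite -(big_mkord xpredT F) /index_iota subn0; apply: perm_big.
by apply: uniq_perm => [||n]; rewrite ?fset_uniq ?iota_uniq ?inE.
Qed.

(** * Uniform bounds for coefficients, coordinate projections and finite multipliers *)

Section GreedyBasis.
Variables (R : realType) (k : scalar_kind).
Variable X : preTopologicalLmodType (scalars R k).
Local Notation K := (scalars R k).
Variables (N : X -> R) (x : nat -> X) (xs : nat -> {scalar X}).
Hypothesis NB : quasi_Banach N.
Hypothesis xB : greedy_basis N x xs.

Local Lemma qN : quasi_norm N. Proof. by case: NB. Qed.
Local Lemma xs_x n j : xs n (x j) = (j == n)%:R.
Proof. by case: xB => -[]. Qed.
Local Hint Resolve qN xs_x : core.
Local Notation S := (partial_sum x xs).

(** M-boundedness bounds the products of the norms of [x n] and [xs n]; dividing by a positive lower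
    bound of the [N (x n)] leaves a bound for the functionals. *)
Lemma coef_bounded : exists2 B : R, 0 <= B &
  forall n f, modulus (xs n f) <= B * N f.
Proof.
case: xB => _ Mb [Nlo Nhi] _.
have Nx_gt0 n : 0 < N (x n).
  rewrite lt_neqAle qnorm_ge0// andbT eq_sym; apply/negP => /eqP.
  move/(qnorm_eq0 qN) => x0; have := xs_x n n.
  by rewrite x0 linear0 eqxx => /esym/eqP; rewrite oner_eq0.
have [a a0 Na] : exists2 a : R, 0 < a & forall n, a <= N (x n).
  move: Nlo; set I := ereal_inf _ => I0.
  have IN n : (I <= (N (x n))%:E)%E by apply: ereal_inf_lbound; exists n.
  case: I I0 IN => [r|//|//] => [|_ /(_ 0%N)]; last by rewrite leye_eq.
  by rewrite lte_fin => r0 rN; exists r => // n; rewrite -lee_fin.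
move: Mb; rewrite /M_bounded; set I := ereal_sup _ => Ioo.
have NI n : ((N (x n))%:E * op_norm N (@modulus R k) (xs n) <= I)%E.
  by apply: ereal_sup_ubound; exists n.
have unit_bound n f : N f <= 1 -> ((N (x n) * modulus (xs n f))%:E <= I)%E.
  move=> Nf1; apply: le_trans (NI n); rewrite EFinM lee_pmul2l// ?lte_fin//.
  by apply: ereal_sup_ubound; exists f.
(* Testing with the vector 0 shows that [I] is nonnegative, in particular not [-oo]. *)
have [B B0 IB] : exists2 B : R, 0 <= B & (I <= B%:E)%E.
  have := unit_bound 0%N 0; rewrite (qnorm0 qN) => /(_ ler01).
  rewrite linear0 modulus0 mulr0.
  case: I Ioo {NI unit_bound} => [r _|//|//].
  by rewrite lee_fin => r0; exists r.
exists (B / a) => [|n f]; first by rewrite divr_ge0// ltW.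
have [f0|Nf0] := eqVneq (N f) 0.
  by rewrite f0 mulr0 (qnorm_eq0 qN f0) linear0 modulus0.
have Nf_gt0 : 0 < N f by rewrite lt_neqAle eq_sym Nf0 qnorm_ge0.
(* The scalar [c] normalises [f]. *)
have [|c c0] := @modulus_surj R k (N f)^-1; first by rewrite invr_ge0 ltW.
have := unit_bound n (c *: f); rewrite qnormZ// c0 mulVf// => /(_ (lexx _)).
move=> /le_trans/(_ IB); rewrite lee_fin linearZ /= modulusM c0.
rewrite mulrCA mulrC ler_pdivrMr// => h.
rewrite mulrAC ler_pdivlMr//; apply: le_trans h.
by rewrite mulrC ler_wpM2r// modulus_ge0.
Qed.

Lemma greedy_bound_ex : exists2 C : R, 1 <= C & greedy_bound N x xs C.
Proof. by case: xB. Qed.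

Lemma supp_card (f : X) (A B : {fset nat}) :
  (forall n, xs n f != 0 -> n \in A) -> (#|` A| <= #|` B|)%N ->
  (supp xs f #<= [set` B])%card.
Proof.
move=> fA AB; apply: (@card_le_trans _ _ _ [set` A]).
  by apply: subset_card_le => n /fA.
by rewrite card_fset_le.
Qed.

(* With [alpha] above all coefficients of [f], [A] is a greedy set of
   [f - S_A f + sum_(n in A) alpha x_n], which differs from [f] only on [A]. *)
Lemma partial_sumC_bounded : exists2 C : R, 1 <= C &
  forall f A, N (f - S A f) <= C * N f.
Proof.
have [C C1 gC] := greedy_bound_ex; exists C => // f A.
have [B B0 coefB] := coef_bounded.
(* The level alpha is [m.+1]: a natural number lies in both scalar fields and is its own modulus. *)
pose m := Num.truncn (B * N f).
have mf n : modulus (xs n f) <= m.+1%:R.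
  apply: le_trans (coefB n f) _; apply/ltW.
  by have /andP[] := truncn_itv (mulr_ge0 B0 (qnorm_ge0 qN f)).
pose z : X := \sum_(n <- A) (m.+1%:R - xs n f) *: x n.
have coefz n : xs n z = if n \in A then m.+1%:R - xs n f else 0.
  by rewrite coef_sum ?fset_uniq.
have Sz : S A (f + z) = S A f + z.
  rewrite /partial_sum -big_split /= !big_seq; apply: eq_bigr => n nA.
  by rewrite linearD /= coefz nA scalerDl.
(* The competitor is [z], which is supported in [A] and leaves [f + z - z = f]. *)
have := gC (f + z) A z; rewrite Sz opprD addrACA subrr addr0 addrK; apply.
  move=> n j; rewrite /= => nA /negP jA; rewrite !linearD /= !coefz nA (negPf jA).
  by rewrite addr0 addrC subrK modulus_nat.
apply: (@supp_card _ A) => // n; rewrite coefz.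
by case: ifP => //; rewrite eqxx.
Qed.

Lemma partial_sum_bounded : exists2 C : R, 0 <= C &
  forall f A, N (S A f) <= C * N f.
Proof.
have [C C1 NC] := partial_sumC_bounded.
have [kappa k1 NK] := qnormD_kappa qN.
exists (kappa * (1 + C)); first by rewrite mulr_ge0//; lra.
move=> f A; rewrite -[S A f](subKr f); apply: le_trans (NK _ _) _.
rewrite qnormN// -mulrA ler_pM2l; last lra.
by rewrite mulrDl mul1r lerD2l.
Qed.

(* Every [c] in the unit ball is [d + e / b] with [d] valued in a finite net and
   [e] in the unit ball.  For [b >= 2 kappa] the error contributes at most half
   of the supremum over the ball, which is finite for fixed [f] and [A], so no
   p-convexification of the quasi-norm is needed. *)
Lemma multiplier_sum_bounded : exists2 C : R, 0 <= C &
  forall f (A : {fset nat}) (c : nat -> K), (forall n, modulus (c n) <= 1) ->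
    N (\sum_(n <- A) (c n * xs n f) *: x n) <= C * N f.
Proof.
have [C C0 NC] := partial_sum_bounded.
have [kappa k1 NK] := qnormD_kappa qN.
pose b := Num.truncn (2 * kappa).
have kb : 2 * kappa <= b.+1%:R.
  have : 0 <= 2 * kappa by lra.
  by move=> /truncn_itv /andP[_ /ltW].
have [D netD] := modulus_net R k b.
have [M M0 NM] := qnorm_sum qN (undup D).
pose m := \sum_(a <- undup D) modulus a.
have m0 : 0 <= m by apply: sumr_ge0 => *; exact: modulus_ge0.
(* A bound for the net-valued part: [C] bounds each projection, [m] the scalars in front, and [M] is
   the cost of summing over the net. *)
pose Q := kappa * (M * (m * C)).
have Q0 : 0 <= Q by rewrite !mulr_ge0//; lra.
exists (2 * Q); first by rewrite mulr_ge0.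
move=> f A c c1.
pose Mf (c : nat -> K) := \sum_(n <- A) (c n * xs n f) *: x n.
pose unit_ball := [set c : nat -> K | forall n, modulus (c n) <= 1].
rewrite -mulrA; apply: (@halving_bound _ [set N (Mf c) | c in unit_ball]).
(* Only finiteness of the supremum matters here, so the bound may depend on [f] and [A]. *)
- have [M' M'0 NM'] := qnorm_sum qN (enum_fset A).
  pose s := \sum_(n <- A) N (xs n f *: x n).
  have s0 : 0 <= s by apply: sumr_ge0 => *; exact: qnorm_ge0.
  exists (M' * s) => _ [c' c'1 <-]; apply: NM' => // n nA.
  rewrite -scalerA qnormZ//; apply: le_trans (_ : N (xs n f *: x n) <= _).
    by rewrite ler_piMl// qnorm_ge0.
  rewrite /s (bigD1_seq n)//= lerDl.
  by apply: sumr_ge0 => *; exact: qnorm_ge0.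
- move=> _ [c' c'1 <-].
  have /choice[d dP] n : exists d, d \in D /\ modulus (c' n - d) <= b.+1%:R^-1.
    by have [d dD cd] := netD _ (c'1 n); exists d.
  have bK : (b.+1%:R : K) != 0 by rewrite pnatr_eq0.
  pose e n := b.+1%:R * (c' n - d n).
  exists (N (Mf e)).
    exists e => // n; rewrite modulusM modulus_nat.
    by rewrite -ler_pdivlMl ?ltr0n// mulr1; case: (dP n).
  have -> : Mf c' = Mf d + b.+1%:R^-1 *: Mf e.
    rewrite /Mf scaler_sumr -big_split /=; apply: eq_bigr => n _.
    by rewrite scalerA -scalerDl mulrA mulKf// -mulrDl addrC subrK.
  apply: le_trans (NK _ _) _; rewrite mulrDr lerD//.
    rewrite /Q -!mulrA ler_pM2l; last lra.
    rewrite /Mf (@partial_sum_level _ _ _ _ _ _ D) => [|n]; last by case: (dP n).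
    apply: NM => [|a aD]; first by rewrite !mulr_ge0 ?qnorm_ge0.
    rewrite qnormZ// ler_pM ?modulus_ge0 ?qnorm_ge0//.
    rewrite /m (bigD1_seq a) ?undup_uniq//= lerDl.
    by apply: sumr_ge0 => *; exact: modulus_ge0.
  rewrite qnormZ// modulusV modulus_nat mulrA mulrC ler_wpM2l ?qnorm_ge0//.
  rewrite ler_pdivrMr ?ltr0n//; lra.
- by exists c.
Qed.

(** * Approximation by partial sums, the lattice estimate, and multipliers on the whole space *)

Lemma span_approx f (e : R) : 0 < e -> exists m (a : nat -> K),
  N (f - \sum_(n < m) a n *: x n) < e.
Proof.
move=> e0; case: xB => -[cl _ _] _ _ _; case: NB => _ topN _.
have : closure (lin_span x) f by rewrite cl.
have fe : nbhs f (qball N f e) by rewrite topN; exists e.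
by move=> /(_ _ fe)[_ [[m [a ->]] h]]; exists m, a.
Qed.

Lemma partial_sum_approx f (e : R) : 0 < e ->
  exists m, N (f - S [fset n in iota 0 m]%fset f) < e.
Proof.
move=> e0; have [C C1 NC] := partial_sumC_bounded.
have C0 : 0 < C by lra.
have [m [a]] := span_approx f (divr_gt0 e0 C0).
set z := \sum_(n < m) _ => fz; exists m.
(* The projection fixes [z], so the remainder of [f] is that of [f - z], which is uniformly
   controlled. *)
have -> : f - S [fset n in iota 0 m]%fset f =
    (f - z) - S [fset n in iota 0 m]%fset (f - z).
  suff Sz : S [fset n in iota 0 m]%fset z = z.
    by rewrite partial_sumB Sz opprB addrA subrK.
  rewrite /partial_sum sum_segment; apply: eq_bigr => n _.
  by rewrite coef_sum_ord// ltn_ord.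
by apply: le_lt_trans (NC _ _) _; rewrite -ltr_pdivlMl// mulrC.
Qed.

(** The partial sums of [f - g] all vanish, yet they approximate [f - g]. *)
Lemma coef_inj f g : (forall n, xs n f = xs n g) -> f = g.
Proof.
move=> fg; apply/eqP; rewrite -subr_eq0; apply/eqP; apply: (qnorm_eq0 qN); apply/eqP.
rewrite eq_le qnorm_ge0// andbT leNgt; apply/negP => /(partial_sum_approx (f - g))[m].
rewrite (_ : S _ _ = 0) ?subr0 ?ltxx//.
by rewrite /partial_sum big1// => n _; rewrite linearB /= fg subrr scale0r.
Qed.

(** A quasi-norm need not be continuous, so passing to the limit costs a factor [kappa]. *)
Lemma qnorm_le_partial_sums : exists2 L : R, 0 <= L &
  forall g b, (forall A, N (S A g) <= b) -> N g <= L * b.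
Proof.
have [kappa k1 NK] := qnormD_kappa qN.
have k0 : 0 < kappa by lra.
exists kappa => [|g b Sb]; first exact: ltW.
apply/ler_addgt0Pr => e e0; have [m gm] := partial_sum_approx g (divr_gt0 e0 k0).
rewrite -[g in N g](subrK (S [fset n in iota 0 m]%fset g)).
apply: le_trans (NK _ _) _; rewrite -ler_pdivlMl// mulrDr mulKf ?gt_eqF//.
by rewrite addrC lerD// mulrC ltW.
Qed.

(** Each partial sum of [g] is a finite multiplier applied to [f], with the quotients of
    coefficients as multiplier sequence. *)
Lemma qnorm_le_coef : exists2 L : R, 0 <= L & forall g f,
  (forall n, modulus (xs n g) <= modulus (xs n f)) -> N g <= L * N f.
Proof.
have [L L0 NL] := qnorm_le_partial_sums.
have [C C0 NC] := multiplier_sum_bounded.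
exists (L * C) => [|g f gf]; first exact: mulr_ge0.
rewrite -mulrA; apply: NL => A.
have -> : S A g = \sum_(n <- A) (xs n g / xs n f * xs n f) *: x n.
  (* Where the coefficient of [f] vanishes, so does that of [g], and the quotient is harmless. *)
  apply: eq_bigr => n _; have [f0|f0] := eqVneq (xs n f) 0; last first.
    by rewrite divfK.
  have := gf n; rewrite f0 modulus0 mulr0 => g0; congr (_ *: _).
  by apply: modulus_eq0; apply/eqP; rewrite eq_le g0 modulus_ge0.
apply: (NC _ _ (fun n => xs n g / xs n f)) => n; rewrite modulusM modulusV.
have [f0|f0] := eqVneq (modulus (xs n f)) 0; first by rewrite f0 invr0 mulr0.
by rewrite ler_pdivrMr ?mul1r// lt_neqAle eq_sym f0 modulus_ge0.
Qed.

(** The finite sums [u m] are Cauchy because the multiplier bound applies to the tails of [f];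
    continuity of the functionals identifies the coefficients of the limit. *)
Lemma multiplier_coef (c : nat -> K) f : (forall n, modulus (c n) <= 1) ->
  exists g, forall n, xs n g = c n * xs n f.
Proof.
move=> c1; have [C C0 NC] := multiplier_sum_bounded.
have [B B0 coefB] := coef_bounded.
pose u m : X := \sum_(n <- [fset n in iota 0 m]%fset) (c n * xs n f) *: x n.
have coefu m n : xs n (u m) = if (n < m)%N then c n * xs n f else 0.
  by rewrite coef_sum ?fset_uniq// inE /= mem_iota.
have cauchy e : 0 < e -> exists g, (u @ \oo) (qball N g e).
  move=> e0; have C1 : 0 < C + 1 by lra.
  have [p fp] := partial_sum_approx f (divr_gt0 e0 C1).
  exists (u p); exists p => // m /= pm; rewrite /qball /= -qnormN// opprB.
  set fS := f - _ in fp.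
  have -> : u m - u p =
      \sum_(n <- [fset n in iota 0 m]%fset) (c n * xs n fS) *: x n.
    apply: coef_inj => n; rewrite linearB /= !coefu coef_sum ?fset_uniq//.
    rewrite linearB /= coef_partial_sum// !inE /= !mem_iota /= !add0n.
    have [np|pn] := ltnP n p; first by rewrite (leq_trans np pm) !subrr mulr0.
    by rewrite !subr0.
  apply: le_lt_trans (NC _ _ _ c1) _.
  apply: le_lt_trans (_ : (C + 1) * N fS < e).
    by rewrite ler_wpM2r ?qnorm_ge0//; lra.
  by rewrite -ltr_pdivlMl// mulrC.
have [_ topN complN] := NB.
have [g ug] := complN (u @ \oo) _ cauchy.
exists g => n; apply/eqP; rewrite -subr_eq0; apply/eqP; apply: modulus_eq0; apply/eqP.
rewrite eq_le modulus_ge0 andbT; apply/ler_addgt0Pr => e e0; rewrite add0r.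
have B1 : 0 < B + 1 by lra.
have : nbhs g (qball N g (e / (B + 1))).
  by rewrite topN; exists (e / (B + 1)) => //=; exact: divr_gt0.
(* The index is large enough to be close to [g] and exceeds [n], so that [u] already has its final
   coefficient at [n]. *)
move=> /ug[m _ /(_ (maxn m n.+1))] /=; rewrite leq_maxl => /(_ isT) gu.
have := coefB n (g - u (maxn m n.+1)).
rewrite linearB /= coefu leq_maxr => /le_trans; apply.
apply: le_trans (_ : (B + 1) * N (g - u (maxn m n.+1)) <= e).
  by rewrite ler_wpM2r ?qnorm_ge0//; lra.
by rewrite -ler_pdivlMl// mulrC ltW.
Qed.

(** Without such an operator [multiplier_norm] would be [+oo]. Linearity follows from [coef_inj],
    continuity from the lattice estimate. *)
Lemma multiplier_nonempty (c : nat -> K) : (forall n, modulus (c n) <= 1) ->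
  exists2 T : {linear X -> X}, multiplier x c T &
    forall f n, xs n (T f) = c n * xs n f.
Proof.
move=> c1; have /choice[T coefT] f := multiplier_coef f c1.
have linT : linear T.
  move=> a f g; apply: coef_inj => n; rewrite coefT !linearP /= !coefT.
  by rewrite mulrDr mulrCA.
pose Tlin := HB.pack_for {linear X -> X} T (GRing.isLinear.Build _ _ _ _ _ linT).
exists Tlin => //; split=> [|m a]; last first.
  apply: coef_inj => n; rewrite coefT coef_sum_ord//.
  rewrite (@coef_sum_ord _ _ _ x xs _ _ (fun n => c n * a n))//.
  by case: ifP => _; [|exact: mulr0].
have [_ topN _] := NB; have [L L0 NL] := qnorm_le_coef.
move=> f; rewrite /continuous_at => A; rewrite topN => -[e /= e0 eA].
rewrite /nbhs /= -/(nbhs f) topN.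
have L1 : 0 < L + 1 by lra.
exists (e / (L + 1)) => [|g fg]; first exact: divr_gt0.
apply: eA; rewrite /qball /= -(linearB Tlin).
have /NL : forall n, modulus (xs n (T (f - g))) <= modulus (xs n (f - g)).
  by move=> n; rewrite coefT modulusM ler_piMl ?modulus_ge0.
move=> /le_lt_trans; apply.
apply: le_lt_trans (_ : (L + 1) * N (f - g) < e).
  by rewrite ler_wpM2r ?qnorm_ge0//; lra.
by rewrite -ltr_pdivlMl// mulrC.
Qed.

(** * The domination relation *)

Definition dominated (g h : X) : Prop := exists E F : {fset nat},
  [/\ [disjoint E & F]%fset, (#|` E| <= #|` F|)%N,
    forall n, n \in F -> xs n g = 0,
    forall n i, i \in F -> modulus (xs n g) <= modulus (xs i h) &
    forall n, n \notin E -> modulus (xs n g) <= modulus (xs n h)].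

Lemma dominated_coef g h :
  (forall n, modulus (xs n g) <= modulus (xs n h)) -> dominated g h.
Proof. by move=> gh; exists fset0, fset0; split; rewrite ?fdisjoint0X. Qed.

(** The two trades are merged after cancelling the indices that one of them empties and the other
    fills, namely those in [E] and [F'] or in [E'] and [F]. *)
Lemma dominated_trans h g f :
  dominated g h -> dominated h f -> dominated g f.
Proof.
move=> [E [F [EF cardEF gF gleF gleE]]] [E' [F' [EF' cardEF' hF' hleF' hleE']]].
(* The case [g = 0] is split off because [F] and [F'] may then overlap. *)
have [g0|/existsNP[n0 gn0]] := pselect (forall n, xs n g = 0).
  by apply: dominated_coef => n; rewrite g0 modulus0 modulus_ge0.
have FF' : [disjoint F & F']%fset.
  apply/fdisjointP => n nF; apply/negP => nF'; apply: gn0; apply: modulus_eq0.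
  (* At a common index [h] vanishes, which would force every coefficient of [g] to vanish. *)
  have := gleF n0 n nF; rewrite hF'// modulus0 => g0.
  by apply/eqP; rewrite eq_le g0 modulus_ge0.
have gleF' n i : i \in F' -> modulus (xs n g) <= modulus (xs i f).
  move=> iF'; have [nE|/gleE gh] := boolP (n \in E); last first.
    exact: le_trans gh (hleF' _ _ iF').
  (* On [E] the comparison passes through some index of [F], which exists since [#E <= #F]. *)
  have /fset0Pn[j jF] : F != fset0.
    rewrite -cardfs_gt0; apply: leq_trans cardEF; rewrite cardfs_gt0.
    by apply/fset0Pn; exists n.
  exact: le_trans (gleF n j jF) (hleF' _ _ iF').
exists ((E `\` F') `|` (E' `\` F))%fset, ((F' `\` E) `|` (F `\` E'))%fset.
have dEF := elimT (@fdisjointP _ _ _) EF.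
have dEF' := elimT (@fdisjointP _ _ _) EF'.
have dFF' := elimT (@fdisjointP _ _ _) FF'.
split.
- apply/fdisjointP => n; rewrite !inE => /orP[/andP[nF' nE]|/andP[nF nE']].
    by rewrite (negPf nF') nE (negPf (dEF _ nE)) !andbF.
  by rewrite nE' (negPf nF) (negPf (dEF' _ nE')) !andbF.
(* Disjointness makes cardinalities add up on the larger side. The same two intersections are then
   subtracted on both sides, and the inclusions exclude truncated subtraction. *)
- have disjF : ((F' `\` E) `&` (F `\` E') = fset0)%fset.
    apply/fsetP => n; rewrite !inE; apply/negP.
    move=> /andP[/andP[_ nF'] /andP[_ nF]].
    by have := dFF' _ nF; rewrite nF'.
  rewrite !cardfsU disjF cardfs0 subn0; apply: leq_trans (leq_subr _ _) _.
  rewrite !cardfsD (fsetIC F') (fsetIC F).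
  have := fsubset_leq_card (fsubsetIl E F').
  have := fsubset_leq_card (fsubsetIr E F').
  have := fsubset_leq_card (fsubsetIl E' F).
  have := fsubset_leq_card (fsubsetIr E' F).
  lia.
- move=> n; rewrite !inE => /orP[/andP[nE nF']|/andP[_ /gF]//].
  apply: modulus_eq0; apply/eqP; rewrite eq_le modulus_ge0 andbT.
  by have := gleE n nE; rewrite hF'// modulus0.
- move=> n i; rewrite !inE => /orP[/andP[_]|/andP[iE' iF]]; first exact: gleF'.
  exact: le_trans (gleF n i iF) (hleE' _ iE').
- move=> n; rewrite !inE negb_or !negb_and !negbK => /andP[nE nE'].
  have [nF|nF] := boolP (n \in F); first by rewrite gF// modulus0 modulus_ge0.
  have [nF'|nF'] := boolP (n \in F'); first exact: gleF'.
  rewrite (negPf nF) (negPf nF') /= in nE nE'.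
  exact: le_trans (gleE _ nE) (hleE' _ nE').
Qed.

Lemma dominatedZ a g h : dominated g h -> dominated (a *: g) (a *: h).
Proof.
move=> [E [F [EF cardEF gF gleF gleE]]]; exists E, F; split=> // [n nF|n i iF|n nE].
- by rewrite linearZ /= gF// mulr0.
- by rewrite !linearZ /= !modulusM ler_wpM2l ?modulus_ge0 ?gleF.
- by rewrite !linearZ /= !modulusM ler_wpM2l ?modulus_ge0 ?gleE.
Qed.

(** The indices of [A] outside the support of [z] are traded for those of the support outside [A].
    On the former [f - z] has the coefficients of [f], which are large by greediness. *)
Lemma dominated_greedy f (A : {fset nat}) z :
  greedy_set xs f [set` A] -> (supp xs z #<= [set` A])%card ->
  dominated (f - S A f) (f - z).
Proof.
move=> gA zA.
have finz : finite_set (supp xs z) := card_le_finite zA (finite_fset A).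
have [D Dz] := (finite_fsetP.1 finz); rewrite Dz card_fset_le in zA.
have zD n : n \notin D -> xs n z = 0.
  move=> nD; apply/eqP/negP => /negP nz.
  by have : supp xs z n by []; rewrite Dz /= (negPf nD).
exists (D `\` A)%fset, (A `\` D)%fset; split.
- by apply/fdisjointP => n; rewrite !inE => /andP[/negPf -> _]; rewrite andbF.
- by rewrite !cardfsD fsetIC leq_sub2r.
- move=> n; rewrite inE => /andP[_ nA].
  by rewrite linearB /= coef_partial_sum// nA subrr.
- move=> n i; rewrite inE => /andP[iD iA]; rewrite !linearB /= (zD i iD) subr0.
  rewrite coef_partial_sum//; case: ifPn => nA.
    by rewrite subrr modulus0 modulus_ge0.
  by rewrite subr0; apply: gA => //=; exact/negP.
- move=> n; rewrite inE negb_and negbK => /orP[nA|nD]; rewrite !linearB /=.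
    by rewrite coef_partial_sum// nA subrr modulus0 modulus_ge0.
  rewrite (zD n nD) subr0 coef_partial_sum//.
  by case: ifP; rewrite ?subr0// subrr modulus0 modulus_ge0.
Qed.

(** * The equivalent quasi-norm *)

Lemma qnorm_dominated : exists2 L : R, 0 <= L &
  forall g h, dominated g h -> N g <= L * N h.
Proof.
have [kappa k1 NK] := qnormD_kappa qN.
have [L L0 NL] := qnorm_le_coef.
have [C C1 gC] := greedy_bound_ex.
have [D D0 ND] := partial_sum_bounded.
exists (kappa * (C * D + L)); first by rewrite mulr_ge0 ?addr_ge0 ?mulr_ge0//; lra.
move=> g h [E [F [EF cardEF gF gleF gleE]]].
have disj := elimT (@fdisjointP _ _ _) EF.
rewrite -[g in N g](subrK (S E g)) addrC.
apply: le_trans (NK _ _) _; rewrite -mulrA ler_pM2l; last lra.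
rewrite mulrDl lerD//; last first.
  apply: NL => n; rewrite linearB /= coef_partial_sum//.
  case: ifPn => nE; first by rewrite subrr modulus0 modulus_ge0.
  by rewrite subr0 gleE.
have SF : S F (S E g + S F h) = S F h.
  apply: coef_inj => n; rewrite !coef_partial_sum//; case: ifPn => // nF.
  rewrite linearD /= !coef_partial_sum// nF; case: ifP => nE; rewrite ?add0r//.
  by rewrite gF// add0r.
(* Removing the greedy set [F] leaves [S E g]; subtracting the competitor leaves [S F h]. *)
have := gC (S E g + S F h) F (S E g).
rewrite SF addrK (addrC (S E g)) addrK => gCF.
apply: (@le_trans _ _ (C * N (S F h))).
  apply: gCF; last first.
    apply: (@supp_card _ E) => // n; rewrite coef_partial_sum//.
    by case: ifP => //; rewrite eqxx.
  move=> n j /= nF /negP jF; rewrite !linearD /= !coef_partial_sum// nF (negPf jF).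
  have /negPf -> : n \notin E by apply/negP => /disj; rewrite nF.
  rewrite add0r addr0; case: ifP => _; first exact: gleF.
  by rewrite modulus0 modulus_ge0.
by rewrite -mulrA ler_pM2l//; lra.
Qed.

(** The real [sup] is a true supremum: the set contains [N h], and [qnorm_dominated] bounds it. *)
Definition dominated_norm h : R := sup [set N g | g in dominated^~ h].

Local Notation N' := dominated_norm.

Lemma dominated_norm_ge g h : dominated g h -> N g <= N' h.
Proof.
have [L _ NL] := qnorm_dominated => gh; apply: ub_le_sup; last by exists g.
by exists (L * N h) => _ [f fh <-]; exact: NL.
Qed.

Lemma dominated_norm_le h b : (forall g, dominated g h -> N g <= b) -> N' h <= b.
Proof.
move=> hb; apply: ge_sup => [|_ [g gh <-]]; last exact: hb.
by exists (N h), h => //; exact: dominated_coef.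
Qed.

(** This monotonicity, due to transitivity, yields the upper bounds for both constants. *)
Lemma le_dominated_norm g h : dominated g h -> N' g <= N' h.
Proof.
move=> gh; apply: dominated_norm_le => f fg; apply: dominated_norm_ge.
exact: dominated_trans fg gh.
Qed.

Lemma qnorm_le_dominated_norm h : N h <= N' h.
Proof. by apply: dominated_norm_ge; exact: dominated_coef. Qed.

Lemma dominated_norm_le_qnorm : exists2 L : R, 0 < L & forall h, N' h <= L * N h.
Proof.
have [L L0 NL] := qnorm_dominated; exists (L + 1) => [|h]; first lra.
apply: dominated_norm_le => g /NL/le_trans; apply.
by rewrite ler_wpM2r ?qnorm_ge0//; lra.
Qed.

Lemma dominated_normZ a h : N' (a *: h) = modulus a * N' h.
Proof.
have le_scale b f : b != 0 -> N' (b *: f) <= modulus b * N' f.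
  move=> b0; apply: dominated_norm_le => g gf.
  rewrite -(scalerKV b0 g) qnormZ// ler_wpM2l ?modulus_ge0//.
  by apply: dominated_norm_ge; rewrite -[f](scalerK b0); exact: dominatedZ.
have [->|a0] := eqVneq a 0.
  rewrite scale0r modulus0 mul0r; apply/eqP; rewrite eq_le.
  have [L _ N'L] := dominated_norm_le_qnorm.
  have := N'L 0; rewrite (qnorm0 qN) mulr0 => -> /=.
  exact: le_trans (qnorm_ge0 qN _) (qnorm_le_dominated_norm 0).
apply/eqP; rewrite eq_le le_scale//=.
have ma : 0 < modulus a.
  rewrite lt_neqAle modulus_ge0 andbT eq_sym; apply: contra a0 => /eqP.
  by move=> /modulus_eq0 ->.
(* The reverse inequality is [le_scale] for the inverse scalar. *)
rewrite -[h in leLHS](scalerK a0) -ler_pdivlMl// -modulusV.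
by rewrite le_scale// invr_eq0.
Qed.

(** Apart from homogeneity, everything follows from [N <= N' <= L * N]. *)
Lemma dominated_norm_renorming : renorming N'.
Proof.
have [kappa k1 NK] := qnormD_kappa qN.
have [L L0 N'L] := dominated_norm_le_qnorm.
have NN' := qnorm_le_dominated_norm.
split; first split.
- by move=> f; exact: le_trans (qnorm_ge0 qN f) (NN' f).
- move=> f f0; apply: (qnorm_eq0 qN); apply/eqP.
  by rewrite eq_le qnorm_ge0// andbT -f0 NN'.
- exact: dominated_normZ.
- have k0 : 0 < kappa by lra.
  (* The summand 1 makes the constant at least 1 without a lower bound for [L]. *)
  exists (L * kappa + 1) => [|f g]; first by rewrite lerDr mulr_ge0 ?ltW.
  apply: le_trans (N'L _) _; apply: (@le_trans _ _ (L * kappa * (N' f + N' g))).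
    rewrite -mulrA ler_pM2l//; apply: le_trans (NK f g) _.
    by rewrite ler_pM2l// lerD.
  rewrite ler_wpM2r ?lerDl// addr_ge0//.
    exact: le_trans (qnorm_ge0 qN f) (NN' f).
  exact: le_trans (qnorm_ge0 qN g) (NN' g).
move=> f; have [_ -> _] := NB; apply/seteqP; split=> A [e /= e0 eA].
  by exists e => // g /= fg; apply: eA; exact: le_lt_trans (NN' _) fg.
exists (e / L) => [|g /= fg]; first exact: divr_gt0.
by apply: eA; apply: le_lt_trans (N'L _) _; rewrite -ltr_pdivlMl// mulrC.
Qed.

(** * The greedy and the lattice unconditional constants of the new quasi-norm *)

Lemma dominated_norm_greedy : greedy_constant N' x xs = 1%E.
Proof.
apply/eqP; rewrite eq_le; apply/andP; split.
  apply: ereal_inf_lbound; exists 1 => //; split=> // f A z gA zA.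
  by rewrite mul1r; apply: le_dominated_norm; exact: dominated_greedy.
(* The lower bound is built into [greedy_constant], whose candidates are at least 1. *)
by apply: le_ereal_inf_tmp => _ [C [C1 _] <-]; rewrite lee_fin.
Qed.

Lemma dominated_norm_lattice : lattice_unconditional_constant N' x = 1%E.
Proof.
have [qN' _] := dominated_norm_renorming.
apply/eqP; rewrite eq_le; apply/andP; split.
  apply: ge_ereal_sup => _ [c c1 <-].
  have {}c1 n : modulus (c n) <= 1.
    by rewrite -lee_fin; apply: le_trans c1; apply: ereal_sup_ubound; exists n.
  have [T Tc coefT] := multiplier_nonempty c1.
  apply: (@le_trans _ _ (op_norm N' N' T)).
    by apply: ereal_inf_lbound; exists T.
  apply: ge_ereal_sup => _ [f /= f1 <-]; rewrite lee_fin; apply: le_trans f1.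
  apply: le_dominated_norm; apply: dominated_coef => n.
  by rewrite coefT modulusM ler_piMl ?modulus_ge0.
(* For the lower bound, the constant sequence 1 is tested on a normalised multiple of [x 0], which
   its multiplier fixes. *)
apply: (@le_trans _ _ (multiplier_norm N' x (fun=> 1))); last first.
  apply: ereal_sup_ubound; exists (fun=> 1) => //=.
  by apply: ge_ereal_sup => _ [n _ <-]; rewrite modulus1.
apply: le_ereal_inf_tmp => _ [T [_ Tx] <-].
have x0 : N' (x 0%N) != 0.
  apply/eqP => /(qnorm_eq0 qN') x0; have := xs_x 0 0.
  by rewrite x0 linear0 eqxx => /esym/eqP; rewrite oner_eq0.
have [|a a1] := @modulus_surj R k (N' (x 0%N))^-1.
  by rewrite invr_ge0 qnorm_ge0.
have ax1 : N' (a *: x 0%N) = 1 by rewrite qnormZ// a1 mulVf.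
apply: ereal_sup_ubound; exists (a *: x 0%N); first by rewrite /= ax1.
have := Tx 1%N (fun=> a); rewrite !big_ord_recl !big_ord0 /= !addr0 mul1r => ->.
by rewrite ax1.
Qed.

End GreedyBasis.

Local Close Scope classical_set_scope.

Theorem theorem11p5 (R : realType) (k : scalar_kind)
  (X : preTopologicalLmodType (scalars R k)) (N : X -> R)
  (x : nat -> X) (xs : nat -> {scalar X}) :
  quasi_Banach N -> greedy_basis N x xs ->
  exists N' : X -> R,
    [/\ renorming N',
        greedy_constant N' x xs = 1%E
      & lattice_unconditional_constant N' x = 1%E].
Proof.
move=> NB xB; exists (dominated_norm N xs); split.
- exact: dominated_norm_renorming NB xB.
- exact: dominated_norm_greedy NB xB.
- exact: dominated_norm_lattice NB xB.
Qed.
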